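(* Let $0\le a<b$, let $s\in(0,1]$, let $q>1$ and let $p$ be defined by $\frac1p+\frac1q=1$. Let $f:[a,b]\to\mathbb{R}$ be a function such that $f'$ is absolutely continuous on $[a,b]$ and $f''\in L_1[a,b]$. If $|f''|^q$ is $s$-convex on $[a,b]$, then for all $x\in\left[a,\frac{a+b}{2}\right]$ $$\left|\frac{1}{b-a}\int_a^b f(t)\,dt-\frac12\left[f(x)+f(a+b-x)\right]+\frac12\left(x-\frac{3a+b}{4}\right)\left[f'(x)-f'(a+b-x)\right]\right|$$ $$\le \frac{1}{2(b-a)(2p+1)^{1/p}(s+1)^{1/q}}\Big[(x-a)^3\left(|f''(a)|^q+|f''(x)|^q\right)^{1/q}+\frac{(a+b-2x)^3}{4}\left(|f''(x)|^q+|f''(a+b-x)|^q\right)^{1/q}+(x-a)^3\left(|f''(a+b-x)|^q+|f''(b)|^q\right)^{1/q}\Big].$$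
   Context: For $s\in(0,1]$ and an interval $J\subseteq[0,\infty)$, a function $g:J\to\mathbb{R}$ is called $s$-convex (in the second sense) on $J$ if $g(\alpha u+\beta v)\le \alpha^s g(u)+\beta^s g(v)$ for all $u,v\in J$ and all $\alpha,\beta\ge 0$ with $\alpha+\beta=1$. The assumption that $|f''|^q$ is $s$-convex on $[a,b]$ presupposes that $f''$ is defined at every point of $[a,b]$ (one-sided at the endpoints). *)

(* Defs.v *)
From mathcomp Require Import all_boot all_order all_algebra.
From mathcomp Require Import all_classical all_reals all_analysis.

Set Implicit Arguments.
Unset Strict Implicit.
Unset Printing Implicit Defensive.

Import Order.TTheory GRing.Theory Num.Theory.
Import numFieldNormedType.Exports.

Local Open Scope classical_set_scope.
Local Open Scope ring_scope.

(* Functions on a subset A of R are represented by total functions R -> R; the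
   definitions below only look at values taken on A (for x in A).  In particular the
   difference quotients are restricted to A: when A = `[a, b] and a < b, this
   gives the one-sided derivatives at a and b. *)

Definition derivable_on (R : realType) (A : set R) (f : R -> R) (x : R) : Prop :=
  cvg ((f y - f x) / (y - x) @[y --> within A x^']).

(* Junk value unless derivable_on A f x. *)
Definition derive_on (R : realType) (A : set R) (f : R -> R) (x : R) : R :=
  lim ((f y - f x) / (y - x) @[y --> within A x^']).

Definition absolutely_continuous_on (R : realType) (a b : R) (g : R -> R) : Prop :=
  forall e : R, 0 < e -> exists2 d : R, 0 < d &
    forall (n : nat) (u v : 'I_n -> R),
      (forall i, [/\ a <= u i, u i < v i & v i <= b]) ->
      trivIset [set: 'I_n] (fun i => `]u i, v i[%classic) ->
      \sum_(i < n) (v i - u i) < d ->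
      \sum_(i < n) `|g (v i) - g (u i)| < e.

(* s-convexity in the second sense.  For 0 < s, powR gives 0 `^ s = 0. *)
Definition s_convex_on (R : realType) (s : R) (J : set R) (g : R -> R) : Prop :=
  forall u v alpha beta : R, J u -> J v -> 0 <= alpha -> 0 <= beta ->
    alpha + beta = 1 ->
    g (alpha * u + beta * v) <= alpha `^ s * g u + beta `^ s * g v.

(* Main.v *)
Require Import Defs.
From mathcomp Require Import all_boot all_order all_algebra.
From mathcomp Require Import all_classical all_reals all_analysis.
From mathcomp Require Import ring lra.

Import Order.TTheory GRing.Theory Num.Theory.
Import numFieldNormedType.Exports.

Local Open Scope classical_set_scope.
Local Open Scope ring_scope.

(** Write m = (a + b) / 2 and y = a + b - x, and let F be a primitive of f.  For
    a fixed centre c the function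
      M_c t = (t - c)^2 f'(t) - 2 (t - c) f(t) + 2 F(t)
    has derivative (t - c)^2 f''(t), since all other terms cancel.  Adding the
    increments of M_a on [a, x], of M_m on [x, y] and of M_b on [y, b] gives
    2 (b - a) times the quantity inside the absolute value: this is
    [moment_identity], and it replaces two integrations by parts.

    Each increment is the integral of (t - c)^2 f''(t), and Hoelder's inequality
    bounds it by (int |t - c|^(2p))^(1/p) (int |f''|^q)^(1/q).  The s-convexity of
    |f''|^q on a piece [u, v] bounds the second integrand by
      ((v - t)/(v - u))^s |f''(u)|^q + ((t - u)/(v - u))^s |f''(v)|^q,
    whose integral is (v - u)(|f''(u)|^q + |f''(v)|^q)/(s + 1).  Since
    1/p + 1/q = 1 the powers of the length of the piece combine to a cube.

    Both |t - c|^(2p) and this bound have explicit primitives, so Hoelder's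
    inequality is needed only in a form about increments,
    [norm_increment_Holder]: Young's inequality holds pointwise between
    derivatives, and the mean value theorem transfers it to increments.  In this
    way f'' is never integrated: pointwise differentiability of f' in the open
    interval and continuity up to the end points are enough.  The primitives are
    built from t |t|^r, which for r > 0 is differentiable everywhere with
    derivative (r + 1) |t|^r; hence neither the centre of the middle piece nor
    the end points, where the power functions degenerate, need separate care. *)

(** * Inequalities between increments *)

(** The mean value theorem is applied to G - H and to G + H, whose derivatives are
    nonnegative; the two cases differ by the unit e that multiplies H. *)
Lemma norm_increment_le (R : realType) (H H' G G' : R -> R) (u v : R) :
  u <= v ->
  {within `[u, v], continuous H} -> {within `[u, v], continuous G} ->
  (forall t, u < t < v -> is_derive t 1 H (H' t)) ->
  (forall t, u < t < v -> is_derive t 1 G (G' t)) ->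
  (forall t, u < t < v -> `|H' t| <= G' t) ->
  `|H v - H u| <= G v - G u.
Proof.
rewrite le_eqVlt => /predU1P[->|uv]; first by rewrite !subrr normr0.
move=> cH cG dH dG HG.
have incr (e : R) : `|e| = 1 -> e * (H v - H u) <= G v - G u.
  move=> e1.
  have [||c] := @MVT R (G \- e \*: H) (fun t => G' t - e * H' t) u v uv.
  - move=> t; rewrite in_itv/= => tuv.
    by apply: is_deriveB; [exact: dG | apply: is_deriveZ; exact: dH].
  - move=> t; apply: cvgB; first exact: cG.
    by apply: cvgZr; exact: cH.
  rewrite in_itv/= => cuv /= E.
  rewrite -subr_ge0.
  have -> : G v - G u - e * (H v - H u) = (G' c - e * H' c) * (v - u).
    by rewrite -E /= /GRing.scale /=; ring.
  rewrite mulr_ge0 ?subr_ge0 ?(ltW uv)// (le_trans _ (HG _ cuv))//.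
  by rewrite (le_trans (ler_norm _))// normrM e1 mul1r.
rewrite ler_norml; apply/andP; split.
  by have := incr (-1) (ltac:(by rewrite normrN1)); rewrite mulN1r lerNl.
by have := incr 1 (normr1 _); rewrite mul1r.
Qed.

(** With P and Q primitives of X^p and Y^q, the right-hand side is the product of
    norms in Hoelder's inequality.  For all A and B above the two norms, Young's
    inequality for X / A and Y / B shows that |H'| is at most the derivative of a
    combination G of P and Q whose increment is at most A B (1/p + 1/q) = A B.
    Taking A and B strictly above the norms keeps them positive when P or Q has
    increment zero; the bound follows by letting them decrease. *)
Lemma norm_increment_Holder (R : realType) (p q u v : R) (H H' P X Q Y : R -> R) :
  0 < p -> 0 < q -> p^-1 + q^-1 = 1 -> u <= v ->
  {within `[u, v], continuous H} ->
  {within `[u, v], continuous P} -> {within `[u, v], continuous Q} ->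
  (forall t, u < t < v -> is_derive t 1 H (H' t)) ->
  (forall t, u < t < v -> is_derive t 1 P (X t `^ p)) ->
  (forall t, u < t < v -> is_derive t 1 Q (Y t `^ q)) ->
  (forall t, u < t < v -> 0 <= X t) ->
  (forall t, u < t < v -> 0 <= Y t) ->
  (forall t, u < t < v -> `|H' t| <= X t * Y t) ->
  `|H v - H u| <= (P v - P u) `^ p^-1 * (Q v - Q u) `^ q^-1.
Proof.
move=> p0 q0 pq uv cH cP cQ dH dP dQ X0 Y0 HXY.
have incr_ge0 (F F' : R -> R) : {within `[u, v], continuous F} ->
    (forall t, u < t < v -> is_derive t 1 F (F' t)) ->
    (forall t, u < t < v -> 0 <= F' t) -> 0 <= F v - F u.
  move=> cF dF F0; apply: (@le_trans _ _ `|cst 0 v - cst 0 u|) => //.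
  apply: (@norm_increment_le _ _ (cst 0) _ F') => //.
  - by move=> t; apply: cvg_cst.
  - by move=> t tuv /=; rewrite normr0 F0.
have dP0 : 0 <= P v - P u by apply: (incr_ge0 _ _ cP dP) => t _; exact: powR_ge0.
have dQ0 : 0 <= Q v - Q u by apply: (incr_ge0 _ _ cQ dQ) => t _; exact: powR_ge0.
have key (A B : R) : (P v - P u) `^ p^-1 < A -> (Q v - Q u) `^ q^-1 < B ->
    `|H v - H u| <= A * B.
  move=> hA hB.
  have A0 : 0 < A by rewrite (le_lt_trans (powR_ge0 _ _) hA).
  have B0 : 0 < B by rewrite (le_lt_trans (powR_ge0 _ _) hB).
  pose G := (A * B / (A `^ p * p)) \*: P \+ (A * B / (B `^ q * q)) \*: Q.
  apply: (@le_trans _ _ (G v - G u)).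
    apply: (@norm_increment_le _ _ H' G (fun t => A * B / (A `^ p * p) * X t `^ p
       + A * B / (B `^ q * q) * Y t `^ q)); do ?[exact: uv | exact: cH | exact: dH].
    - by move=> t; apply: cvgD; apply: cvgZr; [exact: cP|exact: cQ].
    - by move=> t tuv; apply: is_deriveD; apply: is_deriveZ; [exact: dP|exact: dQ].
    - move=> t tuv; rewrite (le_trans (HXY _ tuv))//.
      have := @conjugate_powR R (X t / A) (Y t / B) p q
         (divr_ge0 (X0 _ tuv) (ltW A0)) (divr_ge0 (Y0 _ tuv) (ltW B0)) p0 q0 pq.
      rewrite -(ler_pM2l (mulr_gt0 A0 B0)) => /le_trans-/(_ _).
      have iA : (A^-1) `^ p = (A `^ p)^-1.
        by rewrite -powR_inv1 ?ltW// -powRrM mulN1r powRN.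
      have iB : (B^-1) `^ q = (B `^ q)^-1.
        by rewrite -powR_inv1 ?ltW// -powRrM mulN1r powRN.
      have X0t := X0 _ tuv; have Y0t := Y0 _ tuv.
      rewrite powRM ?invr_ge0 ?(ltW A0)// powRM ?invr_ge0 ?(ltW B0)// iA iB.
      have -> : A * B * (X t / A * (Y t / B)) = X t * Y t by field; lra.
      apply; rewrite le_eqVlt; apply/orP; left; apply/eqP.
      have ? := powR_gt0 p A0; have ? := powR_gt0 q B0.
      field; do ?[split]; lra.
  have PA : P v - P u <= A `^ p.
    have := @ge0_ler_powR R p (ltW p0) ((P v - P u) `^ p^-1) A.
    rewrite -powRrM mulVf ?gt_eqF// powRr1//; apply; rewrite ?nnegrE ?powR_ge0 ?ltW//.
  have QB : Q v - Q u <= B `^ q.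
    have := @ge0_ler_powR R q (ltW q0) ((Q v - Q u) `^ q^-1) B.
    rewrite -powRrM mulVf ?gt_eqF// powRr1//; apply; rewrite ?nnegrE ?powR_ge0 ?ltW//.
  have Ap := powR_gt0 p A0; have Bq := powR_gt0 q B0.
  have -> : G v - G u = A * B * ((P v - P u) / A `^ p * p^-1 + (Q v - Q u) / B `^ q * q^-1).
    rewrite /G /= /GRing.scale/=; field; do ?[split]; lra.
  have le1 : (P v - P u) / A `^ p * p^-1 + (Q v - Q u) / B `^ q * q^-1 <= 1.
    rewrite -pq; apply: lerD.
      by rewrite ler_piMl ?invr_ge0 ?(ltW p0)// ler_pdivrMr// mul1r.
    by rewrite ler_piMl ?invr_ge0 ?(ltW q0)// ler_pdivrMr// mul1r.
  have AB0 : 0 <= A * B by exact: mulr_ge0 (ltW A0) (ltW B0).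
  by rewrite -[leRHS]mulr1; exact: ler_wpM2l AB0 _ _ le1.
set A0 := (P v - P u) `^ p^-1; set B0 := (Q v - Q u) `^ q^-1.
have A0_ge0 : 0 <= A0 by exact: powR_ge0.
have B0_ge0 : 0 <= B0 by exact: powR_ge0.
have keyB (B : R) : B0 < B -> `|H v - H u| <= A0 * B.
  move=> hB; have B_gt0 : 0 < B by exact: le_lt_trans hB.
  rewrite -ler_pdivrMr//; apply/ler_addgt0Pl => e e0.
  by rewrite ler_pdivrMr//; apply: key => //; rewrite ltrDr.
have [A_gt0|] := ltP 0 A0.
  rewrite mulrC -ler_pdivrMr//; apply/ler_addgt0Pl => e e0.
  by rewrite ler_pdivrMr// mulrC; apply: keyB; rewrite ltrDr.
move=> A_le0; have A_eq0 : A0 = 0 by apply/eqP; rewrite eq_le A_le0 A0_ge0.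
rewrite A_eq0 mul0r.
by have := keyB (B0 + 1) (ltac:(by rewrite ltrDl)); rewrite A_eq0 mul0r.
Qed.

(** * Derivatives on an interval and at interior points *)

Lemma is_derive_quotient (R : realType) (g : R -> R) (t l : R) :
  (g y - g t) / (y - t) @[y --> t^'] --> l -> is_derive t 1 g l.
Proof.
move=> gl.
have shiftE : (h + t) @[h --> 0^'] --> t^'.
  move=> U tU; have /nbhs0P tU0 : \forall y \near t, y != t -> U y := tU.
  change (\forall h \near (0 : R), h != 0 -> U (h + t)).
  near=> h => h0; rewrite addrC; apply: (near tU0 h) => //.
  by rewrite -subr_eq0 addrC addKr.
have quotl : h^-1 *: ((g \o shift t) (h *: 1) - g t) @[h --> 0^'] --> l.
  apply: cvg_trans (cvg_comp _ _ shiftE gl).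
  apply: near_eq_cvg; near=> h.
  by rewrite /= /GRing.scale /= mulr1 addrK mulrC.
apply: DeriveDef; first by apply/cvg_ex; exists l.
exact: cvg_lim.
Unshelve. all: by end_near. Qed.

(** Near an interior point the restriction of the difference quotient to [a, b] is
    vacuous: the two filters of punctured neighbourhoods coincide. *)
Lemma is_derive_derive_on (R : realType) (a b t : R) (g : R -> R) :
  a < t < b -> derivable_on `[a, b] g t ->
  is_derive t 1 g (derive_on `[a, b] g t).
Proof.
move=> /andP[lt_at lt_tb] dg; apply: is_derive_quotient.
suff tab : within `[a, b] t^' = t^'.
  by rewrite -[X in _ @[_ --> X] --> _]tab; exact: dg.
rewrite eqEsubset; split; last by move=> U tU; apply: filterS tU => y Uy _.
move=> U tU.
change (\forall y \near t, y != t -> U y).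
have {}tU : \forall y \near t, y != t -> y \in `[a, b] -> U y := tU.
near=> y => yt; apply: (near tU y) => //.
rewrite in_itv/=; apply/andP; split; apply/ltW.
  by near: y; exact: lt_nbhsr.
by near: y; exact: lt_nbhsl.
Unshelve. all: by end_near. Qed.

(** The increment of g is its difference quotient, which stays bounded because it
    converges, times the increment of the variable. *)
Lemma derivable_on_within_continuous (R : realType) (A : set R) (g : R -> R) :
  (forall t, A t -> derivable_on A g t) -> {within A, continuous g}.
Proof.
move=> dg; apply/subspace_continuousP => t At.
have : (g y - g t) / (y - t) @[y --> within A t^'] --> derive_on A g t := dg t At.
set l := derive_on A g t => quotl.
have quot_bd : \forall y \near t, y != t -> A y ->
    `|l - (g y - g t) / (y - t)| < 1.
  by move/cvgrPdist_lt : quotl; apply.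
apply/cvgrPdist_lt => e e0.
change (\forall y \near t, A y -> `|g t - g y| < e).
have M0 : 0 < `|l| + 1 by rewrite ltr_wpDl.
near=> y => Ay.
have [->|yt] := eqVneq y t; first by rewrite subrr normr0.
have bd : `|(g y - g t) / (y - t)| <= `|l| + 1.
  have := near quot_bd y _ yt Ay => /(_ _)/ltW dl.
  rewrite -[X in `|X|](subKr l) (le_trans (ler_normB _ _))// lerD2l dl//.
have -> : g t - g y = (g y - g t) / (y - t) * (t - y).
  by field; rewrite subr_eq0.
rewrite normrM; apply: (@le_lt_trans _ _ ((`|l| + 1) * `|t - y|)).
  by rewrite ler_wpM2r.
rewrite mulrC -ltr_pdivlMr//.
by near: y; apply: (@cvgr_dist_lt _ _ _ _ _ id) => //; exact: divr_gt0.
Unshelve. all: by end_near. Qed.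

(** * Signed powers *)

(** For t > 0 this is the rule for powers, for t < 0 it follows by oddness, and at 0
    the difference quotient is |y|^r, which tends to 0. *)
Lemma is_derive_signed_powR (R : realType) (r t : R) : 0 < r ->
  is_derive t 1 (fun y : R => y * `|y| `^ r) ((r + 1) * `|t| `^ r).
Proof.
move=> r0.
have pos (y : R) : 0 < y ->
    is_derive y 1 (fun y : R => y * `|y| `^ r) ((r + 1) * `|y| `^ r).
  move=> y0; apply: (@near_eq_is_derive _ _ _ (fun y : R => y * y `^ r)) => //.
    near=> z; rewrite gtr0_norm//; near: z; exact: lt_nbhsr.
  have := @is_derive1_powR R r y y0 => h.
  apply: is_derive_eq.
  rewrite /GRing.scale/= gtr0_norm// mulr1 mulrCA mulr_powRB1 ?ltW//; ring.
have [t0|t0|->] := ltgtP t 0; last 2 first.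
- exact: pos.
- rewrite normr0 powR0 ?gt_eqF// mulr0; apply: is_derive_quotient.
  apply/cvgr0Pnorm_lt => e e0.
  have d0 : 0 < e `^ r^-1 by exact: powR_gt0.
  near=> y.
  have y0 : y != 0 by near: y; exact: nbhs_dnbhs_neq.
  rewrite mul0r !subr0 mulrC mulKf// ger0_norm ?powR_ge0//.
  have -> : e = (e `^ r^-1) `^ r.
    by rewrite -powRrM mulVf ?gt_eqF// powRr1// ltW.
  apply: gt0_ltr_powR => //; rewrite ?nnegrE ?powR_ge0//.
  by near: y; exact: dnbhs0_lt.
- have := pos (- t); rewrite oppr_gt0 => /(_ t0) dN.
  have dopp : is_derive t 1 (-%R : R -> R) (-1) by exact: is_deriveNid.
  have := @is_deriveN _ _ _ _ _ _ _ (@is_derive1_comp _ _ _ _ _ _ dN dopp).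
  rewrite normrN mulrN1 opprK; congr (is_derive _ _ _ _).
  by apply/funext => y; rewrite opprfctE /= normrN mulNr opprK.
Unshelve. all: by end_near. Qed.

Lemma is_derive_signed_powR_affine (R : realType) (r c k t : R) : 0 < r ->
  is_derive t 1 (fun y : R => (k * (y - c)) * `|k * (y - c)| `^ r)
    ((r + 1) * `|k * (t - c)| `^ r * k).
Proof.
move=> r0.
have dk : is_derive t 1 (fun y : R => k * (y - c)) k.
  by apply: is_derive_eq; rewrite /GRing.scale/=; ring.
exact: (@is_derive1_comp R (fun y => y * `|y| `^ r) (fun y => k * (y - c)) _ _ _
  (is_derive_signed_powR _ _ (k * (t - c)) r0) dk).
Qed.

(** * Second moments about a point *)

Lemma is_derive_integral (R : realType) (a b t : R) (f : R -> R) :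
  a < t < b -> {within `[a, b], continuous f} ->
  is_derive t 1 (fun y => \int[@lebesgue_measure R]_(z in `[a, y]) f z) (f t).
Proof.
move=> /andP[lt_at lt_tb] cf.
have int_f := continuous_compact_integrable (@segment_compact R a b) cf.
have ft : {for t, continuous f}.
  apply: (within_continuous_continuous (lt_trans lt_at lt_tb) cf).
  by rewrite in_itv/= lt_at.
have [dF F'] := continuous_FTC1_closed lt_tb int_f lt_at ft.
apply: DeriveDef; first exact: dF.
by rewrite -derive1E.
Qed.

Lemma continuous_integral (R : realType) (a b : R) (f : R -> R) :
  a <= b -> {within `[a, b], continuous f} ->
  {within `[a, b], continuous
    (fun y => \int[@lebesgue_measure R]_(z in `[a, y]) f z)}.
Proof.
move=> ab cf.
exact: parameterized_integral_continuous ab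
  (continuous_compact_integrable (@segment_compact R a b) cf).
Qed.

(** A primitive of (t - c)^2 f''(t) when f is the derivative of F and f1 that of f;
    its increments are second moments of f'' about c. *)
Definition moment (R : realType) (F f f1 : R -> R) (c t : R) : R :=
  (t - c) ^+ 2 * f1 t - 2 * (t - c) * f t + 2 * F t.
Arguments moment {R}.

Lemma is_derive_moment (R : realType) (F f f1 : R -> R) (c t df1 : R) :
  is_derive t 1 F (f t) -> is_derive t 1 f (f1 t) -> is_derive t 1 f1 df1 ->
  is_derive t 1 (moment F f f1 c) ((t - c) ^+ 2 * df1).
Proof.
move=> dF df ddf; rewrite /moment.
apply: is_derive_eq; rewrite /GRing.scale/=; ring.
Qed.

Lemma continuous_moment (R : realType) (A : set R) (F f f1 : R -> R) (c : R) :
  {within A, continuous F} -> {within A, continuous f} ->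
  {within A, continuous f1} -> {within A, continuous (moment F f f1 c)}.
Proof.
move=> cF cf cf1.
have cX : {within A, continuous (fun y => y - c)}.
  by apply: continuous_subspaceT => y; apply: cvgB; [exact: cvg_id|exact: cvg_cst].
move=> t; rewrite /moment; apply: cvgD; first apply: cvgB.
- by apply: cvgM; [apply: cvgM; exact: cX | exact: cf1].
- by apply: cvgM; [apply: cvgM; [exact: cvg_cst|exact: cX] | exact: cf].
- by apply: cvgM; [exact: cvg_cst | exact: cF].
Qed.

Lemma sqr_powR (R : realType) (p z : R) : (z ^+ 2) `^ p = `|z| `^ (2 * p).
Proof. by rewrite powRrM powR_mulrn// real_normK// num_real. Qed.

(** Hoelder's inequality for (t - c)^2 |f''(t)|, with A and B in the role of the
    values of |f''|^q at u and v.  The q-th root of the convexity bound, rather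
    than |f''| itself, is taken as second factor: its q-th power has an explicit
    primitive. *)
Lemma moment_increment_Holder (R : realType)
    (s p q u v c A B : R) (F f f1 f2 : R -> R) :
  0 < s -> 0 < p -> 0 < q -> p^-1 + q^-1 = 1 -> u < v -> 0 <= A -> 0 <= B ->
  {within `[u, v], continuous F} -> {within `[u, v], continuous f} ->
  {within `[u, v], continuous f1} ->
  (forall t, u < t < v -> is_derive t 1 F (f t)) ->
  (forall t, u < t < v -> is_derive t 1 f (f1 t)) ->
  (forall t, u < t < v -> is_derive t 1 f1 (f2 t)) ->
  (forall t, u < t < v -> `|f2 t| `^ q <=
     ((v - t) / (v - u)) `^ s * A + ((t - u) / (v - u)) `^ s * B) ->
  `|moment F f f1 c v - moment F f f1 c u| <=
    (((v - c) * `|v - c| `^ (2 * p) - (u - c) * `|u - c| `^ (2 * p))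
       / (2 * p + 1)) `^ p^-1 *
    ((v - u) * (A + B) / (s + 1)) `^ q^-1.
Proof.
move=> s0 p0 q0 pq uv A0 B0 cF cf cf1 dF df df1 maj.
have L0 : 0 < v - u by rewrite subr_gt0.
have p20 : 0 < 2 * p by rewrite mulr_gt0.
pose S r k d y : R := (k * (y - d)) * `|k * (y - d)| `^ r.
have cS r k d : 0 < r -> {within `[u, v], continuous (S r k d)}.
  move=> r0; apply: derivable_within_continuous => y _.
  by have [] := is_derive_signed_powR_affine _ r d k y r0.
(* P and Q are primitives of |t - c|^(2p) and of the convexity bound; in Q both
   affine arguments have slope (v - u)^-1, the one based at v being negative. *)
pose P := (2 * p + 1)^-1 \*: S (2 * p) 1 c.
pose Q := ((v - u) / (s + 1)) \*:
  (B \*: S s (v - u)^-1 u \+ A \*: S s (v - u)^-1 v).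
pose g t := ((v - t) / (v - u)) `^ s * A + ((t - u) / (v - u)) `^ s * B.
have g0 t : 0 <= g t by rewrite addr_ge0// mulr_ge0// powR_ge0.
have -> : ((v - c) * `|v - c| `^ (2 * p) - (u - c) * `|u - c| `^ (2 * p))
    / (2 * p + 1) = P v - P u.
  by rewrite /P /S /= /GRing.scale/= !mul1r -mulrBr mulrC.
have -> : (v - u) * (A + B) / (s + 1) = Q v - Q u.
  rewrite /Q /S /= /GRing.scale/= !subrr !mulr0 !mul0r !mulr0 mulVf ?gt_eqF//.
  have -> : (v - u)^-1 * (u - v) = -1 by field; lra.
  rewrite normrN normr1 powR1; field; lra.
apply: (@norm_increment_Holder _ p q u v _ (fun t => (t - c) ^+ 2 * f2 t)
  P (fun t => (t - c) ^+ 2) Q (fun t => g t `^ q^-1) p0 q0 pq (ltW uv)).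
- exact: continuous_moment cF cf cf1.
- by move=> t; apply: cvgZr; exact: cS.
- move=> t; apply: cvgZr; apply: cvgD; apply: cvgZr; exact: cS.
- by move=> t tuv; apply: is_derive_moment; [exact: dF|exact: df|exact: df1].
- move=> t tuv; rewrite sqr_powR.
  have dS := is_derive_signed_powR_affine _ (2 * p) c 1 t p20.
  have := @is_deriveZ _ _ _ _ (2 * p + 1)^-1 _ _ _ dS.
  congr (is_derive _ _ _ _).
  by rewrite /GRing.scale/= mul1r mulr1 mulKf// gt_eqF// addr_gt0.
- move=> t /andP[ut tv].
  have dSu := is_derive_signed_powR_affine _ s u (v - u)^-1 t s0.
  have dSv := is_derive_signed_powR_affine _ s v (v - u)^-1 t s0.
  have := @is_deriveZ _ _ _ _ ((v - u) / (s + 1)) _ _ _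
    (@is_deriveD _ _ _ _ _ _ _ _ _ (@is_deriveZ _ _ _ _ B _ _ _ dSu)
      (@is_deriveZ _ _ _ _ A _ _ _ dSv)).
  congr (is_derive _ _ _ _).
  rewrite -powRrM mulVf ?gt_eqF// powRr1// /GRing.scale/=.
  have -> : `|(v - u)^-1 * (t - u)| = (t - u) / (v - u).
    by rewrite ger0_norm mulrC// divr_ge0 ?ltW// subr_gt0.
  have -> : `|(v - u)^-1 * (t - v)| = (v - t) / (v - u).
    by rewrite normrM distrC mulrC !gtr0_norm ?invr_gt0// subr_gt0.
  rewrite /g; field; lra.
- by move=> t _; exact: sqr_ge0.
- by move=> t _; exact: powR_ge0.
- move=> t tuv; rewrite normrM ger0_norm ?sqr_ge0// ler_wpM2l ?sqr_ge0//.
  have -> : `|f2 t| = (`|f2 t| `^ q) `^ q^-1.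
    by rewrite -powRrM mulfV ?gt_eqF// powRr1.
  apply: ge0_ler_powR; rewrite ?nnegrE ?powR_ge0 ?invr_ge0 ?(ltW q0)//.
  exact: maj.
Qed.

(** The integral of |t - c|^(2p) over a piece of length n h is n h^(2p+1) / (2p + 1),
    with n = 1 when c is an end point and n = 2, h the half-length, when c is the
    midpoint.  By conjugacy n and h each recombine to exponent 1, and h gains the
    exponent 2 from h^(2p). *)
Lemma Holder_constant (R : realType) (s p q n h S : R) :
  0 < s -> 0 < p -> 0 < q -> p^-1 + q^-1 = 1 -> 0 <= n -> 0 <= h -> 0 <= S ->
  (n * (h * h `^ (2 * p)) / (2 * p + 1)) `^ p^-1 *
    (n * h * S / (s + 1)) `^ q^-1 =
  n * h ^+ 3 * S `^ q^-1 / ((2 * p + 1) `^ p^-1 * (s + 1) `^ q^-1).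
Proof.
move=> s0 p0 q0 pq n0 h0 S0.
have p1 : 0 < 2 * p + 1 by rewrite addr_gt0// mulr_gt0.
have s1 : 0 < s + 1 by rewrite addr_gt0.
have VE (x r : R) : 0 < x -> x^-1 `^ r = (x `^ r)^-1.
  by move=> x0; rewrite -powR_inv1 ?ltW// -powRrM mulN1r powRN.
have conj (x : R) : 0 <= x -> x `^ p^-1 * x `^ q^-1 = x.
  move=> x0; rewrite -powRD; first by rewrite pq powRr1.
  by rewrite pq oner_eq0.
have h2p : (h `^ (2 * p)) `^ p^-1 = h ^+ 2.
  by rewrite -powRrM mulfK ?gt_eqF// powR_mulrn.
have hh : 0 <= h * h `^ (2 * p) by rewrite mulr_ge0// powR_ge0.
have nS : 0 <= n * h * S by rewrite !mulr_ge0.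
have nhh : 0 <= n * (h * h `^ (2 * p)) by exact: mulr_ge0.
have ip : 0 <= (2 * p + 1)^-1 by rewrite invr_ge0 ltW.
have is1 : 0 <= (s + 1)^-1 by rewrite invr_ge0 ltW.
rewrite (powRM _ nhh ip) (powRM _ n0 hh) (powRM _ h0 (powR_ge0 _ _)).
rewrite (powRM _ nS is1) (powRM _ (mulr_ge0 n0 h0) S0) (powRM _ n0 h0).
rewrite h2p !VE//.
transitivity ((n `^ p^-1 * n `^ q^-1) * ((h `^ p^-1 * h `^ q^-1) * h ^+ 2) *
    S `^ q^-1 / ((2 * p + 1) `^ p^-1 * (s + 1) `^ q^-1)).
  by rewrite invfM; ring.
by rewrite !conj// -exprS.
Qed.

(** * Bounds from s-convexity *)

Lemma s_convex_on_chord (R : realType) (s a b u v t : R) (g : R -> R) :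
  s_convex_on s `[a, b] g -> a <= u -> u < v -> v <= b -> u <= t <= v ->
  g t <= ((v - t) / (v - u)) `^ s * g u + ((t - u) / (v - u)) `^ s * g v.
Proof.
move=> cvx au uv vb /andP[ut tv].
have vu : 0 < v - u by rewrite subr_gt0.
have Ju : `[a, b]%classic u by rewrite /= in_itv/= au (le_trans (ltW uv)).
have Jv : `[a, b]%classic v by rewrite /= in_itv/= vb (le_trans au (ltW uv)).
have := cvx u v ((v - t) / (v - u)) ((t - u) / (v - u)) Ju Jv.
have -> : (v - t) / (v - u) * u + (t - u) / (v - u) * v = t by field; lra.
apply; [by rewrite divr_ge0 ?(ltW vu)// subr_ge0..|].
by field; lra.
Qed.

(** One lemma for the three pieces: h is the distance from c to the far ends of the
    piece, and n counts the sides of c on which the piece extends. *)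
Lemma s_convex_moment_increment_le (R : realType)
    (a b s p q u v c n h : R) (F f : R -> R) :
  let f1 := derive_on `[a, b] f in
  let f2 := derive_on `[a, b] f1 in
  0 < s -> 0 < p -> 0 < q -> p^-1 + q^-1 = 1 ->
  {within `[a, b], continuous F} ->
  (forall t, a < t < b -> is_derive t 1 F (f t)) ->
  (forall t, a <= t <= b -> derivable_on `[a, b] f t) ->
  (forall t, a <= t <= b -> derivable_on `[a, b] f1 t) ->
  s_convex_on s `[a, b] (fun t => `|f2 t| `^ q) ->
  a <= u -> u <= v -> v <= b -> 0 <= n -> 0 <= h ->
  v - u = n * h ->
  (v - c) * `|v - c| `^ (2 * p) - (u - c) * `|u - c| `^ (2 * p) =
    n * (h * h `^ (2 * p)) ->
  `|moment F f f1 c v - moment F f f1 c u| <=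
    n * h ^+ 3 * (`|f2 u| `^ q + `|f2 v| `^ q) `^ q^-1
      / ((2 * p + 1) `^ p^-1 * (s + 1) `^ q^-1).
Proof.
move=> f1 f2 s0 p0 q0 pq cF dF df df1 cvx au uv vb n0 h0 vuE kerE.
have [uv_eq|uv_neq] := eqVneq u v.
  by rewrite uv_eq subrr normr0 !(mulr_ge0, invr_ge0, powR_ge0, exprn_ge0).
have {uv_neq}ltuv : u < v by rewrite lt_neqAle uv_neq.
have sub : `[u, v]%classic `<=` `[a, b]%classic.
  move=> t /=; rewrite !in_itv/= => /andP[ut tv].
  by rewrite (le_trans au ut) (le_trans tv vb).
have cf : {within `[a, b], continuous f}.
  by apply: derivable_on_within_continuous => t /=; rewrite in_itv/=; exact: df.
have cf1 : {within `[a, b], continuous f1}.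
  by apply: derivable_on_within_continuous => t /=; rewrite in_itv/=; exact: df1.
have inner t : u < t < v -> a < t < b.
  by move=> /andP[ut tv]; rewrite (le_lt_trans au ut) (lt_le_trans tv vb).
have inner' t : u < t < v -> a <= t <= b.
  by move=> /inner/andP[at_ tb]; rewrite !ltW.
have := @moment_increment_Holder R s p q u v c (`|f2 u| `^ q) (`|f2 v| `^ q)
  F f f1 f2 s0 p0 q0 pq ltuv (powR_ge0 _ _) (powR_ge0 _ _)
  (continuous_subspaceW sub cF) (continuous_subspaceW sub cf)
  (continuous_subspaceW sub cf1).
rewrite kerE vuE Holder_constant ?addr_ge0 ?powR_ge0//; apply.
- by move=> t /inner; exact: dF.
- move=> t tuv; apply: is_derive_derive_on; first exact: inner.
  by apply: df; exact: inner'.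
- move=> t tuv; apply: is_derive_derive_on; first exact: inner.
  by apply: df1; exact: inner'.
- move=> t /andP[ut tv].
  by rewrite -vuE; apply: (s_convex_on_chord _ _ _ _ _ _ _ _ cvx) => //; rewrite !ltW.
Qed.

(** * The inequality *)

(** With y = a + b - x and h = (a + b) / 2 - x, so that x - a + h = (b - a) / 2, the coefficient of f'(x) - f'(y) in the
    sum of increments is (x - a)^2 - h^2 = (b - a) (x - (3a + b) / 4), the one of
    f(x) + f(y) is -(b - a), and the primitives telescope to 2 (F(b) - F(a)). *)
Lemma moment_identity (R : realType) (a b x : R) (F f f1 : R -> R) :
  a < b -> F a = 0 ->
  (b - a)^-1 * F b - 2^-1 * (f x + f (a + b - x))
    + 2^-1 * (x - (3 * a + b) / 4) * (f1 x - f1 (a + b - x)) =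
  (2 * (b - a))^-1 *
    ((moment F f f1 a x - moment F f f1 a a)
     + (moment F f f1 ((a + b) / 2) (a + b - x) - moment F f f1 ((a + b) / 2) x)
     + (moment F f f1 b b - moment F f f1 b (a + b - x))).
Proof.
move=> ab Fa; rewrite /moment Fa; field; lra.
Qed.

Theorem theorem5 (R : realType) (a b s p q : R) (f : R -> R) :
  let f' := derive_on `[a, b] f in
  let f'' := derive_on `[a, b] f' in
  0 <= a -> a < b ->
  0 < s -> s <= 1 ->
  1 < q -> 1 / p + 1 / q = 1 ->
  (forall t : R, a <= t <= b -> derivable_on `[a, b] f t) ->
  absolutely_continuous_on a b f' ->
  (forall t : R, a <= t <= b -> derivable_on `[a, b] f' t) ->
  (@lebesgue_measure R).-integrable `[a, b] (EFin \o f'') ->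
  s_convex_on s `[a, b] (fun t => `|f'' t| `^ q) ->
  forall x : R, a <= x <= (a + b) / 2 ->
  `| 1 / (b - a) * (\int[@lebesgue_measure R]_(t in `[a, b]) f t)
     - 1 / 2 * (f x + f (a + b - x))
     + 1 / 2 * (x - (3 * a + b) / 4) * (f' x - f' (a + b - x)) |
  <= 1 / (2 * (b - a) * (2 * p + 1) `^ (1 / p) * (s + 1) `^ (1 / q)) *
     ( (x - a) ^+ 3 * (`|f'' a| `^ q + `|f'' x| `^ q) `^ (1 / q)
     + (a + b - 2 * x) ^+ 3 / 4
         * (`|f'' x| `^ q + `|f'' (a + b - x)| `^ q) `^ (1 / q)
     + (x - a) ^+ 3
         * (`|f'' (a + b - x)| `^ q + `|f'' b| `^ q) `^ (1 / q) ).
Proof.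
move=> f1 f2 a0 ab s0 s1 q1 pq df ac df1 int2 cvx x /andP[ax xm].
have q0 : 0 < q by lra.
rewrite !div1r in pq *.
have p0 : 0 < p.
  have qi : q^-1 < 1 by rewrite invf_lt1.
  by rewrite -invr_gt0; lra.
set y := a + b - x.
have h1 : 0 <= x - a by lra.
have h2 : 0 <= (a + b) / 2 - x by lra.
have [xy yb ay xb] : [/\ x <= y, y <= b, a <= y & x <= b] by rewrite /y; split; lra.
have yxE : y - x = 2 * ((a + b) / 2 - x) by rewrite /y; lra.
have byE : b - y = 1 * (x - a) by rewrite /y; lra.
have ymE : y - (a + b) / 2 = (a + b) / 2 - x by rewrite /y; lra.
have ybE : y - b = - (x - a) by rewrite /y; lra.
have ba : 0 < 2 * (b - a) by lra.
have sumE (T1 T2 T3 k : R) :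
    1 * (x - a) ^+ 3 * T1 * k + 2 * ((a + b) / 2 - x) ^+ 3 * T2 * k
      + 1 * (x - a) ^+ 3 * T3 * k =
    k * ((x - a) ^+ 3 * T1 + (a + b - 2 * x) ^+ 3 / 4 * T2 + (x - a) ^+ 3 * T3).
  by field.
have cf : {within `[a, b], continuous f}.
  by apply: derivable_on_within_continuous => t /=; rewrite in_itv/=; exact: df.
pose F t := \int[@lebesgue_measure R]_(z in `[a, t]) f z.
have cF : {within `[a, b], continuous F} by exact: continuous_integral (ltW ab) cf.
have dF t : a < t < b -> is_derive t 1 F (f t).
  by move=> tab; exact: is_derive_integral tab cf.
have Fa : F a = 0 by rewrite /F set_itv1 Rintegral_set1.
have le_piece u v c n h := @s_convex_moment_increment_le R a b s p q u v c n h F f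
  s0 p0 q0 pq cF dF df df1 cvx.
rewrite (moment_identity _ _ _ x F f f1 ab Fa) -/y.
set K1 := (2 * p + 1) `^ p^-1; set K2 := (s + 1) `^ q^-1.
have left_le : `|moment F f f1 a x - moment F f f1 a a| <=
    1 * (x - a) ^+ 3 * (`|f2 a| `^ q + `|f2 x| `^ q) `^ q^-1 / (K1 * K2).
  apply: (le_piece a x a 1 (x - a)); rewrite ?mul1r//.
  by rewrite subrr mul0r subr0 ger0_norm.
have mid_le : `|moment F f f1 ((a + b) / 2) y - moment F f f1 ((a + b) / 2) x| <=
    2 * ((a + b) / 2 - x) ^+ 3 * (`|f2 x| `^ q + `|f2 y| `^ q) `^ q^-1 / (K1 * K2).
  apply: (le_piece x y ((a + b) / 2) 2 ((a + b) / 2 - x)) => //.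
  rewrite ymE (distrC x) ger0_norm// -[x - _]opprB.
  by rewrite mulNr opprK; ring.
have right_le : `|moment F f f1 b b - moment F f f1 b y| <=
    1 * (x - a) ^+ 3 * (`|f2 y| `^ q + `|f2 b| `^ q) `^ q^-1 / (K1 * K2).
  apply: (le_piece y b b 1 (x - a)) => //.
  by rewrite ybE subrr mul0r normrN ger0_norm// sub0r mulNr opprK mul1r.
rewrite normrM gtr0_norm ?invr_gt0//.
have -> : (2 * (b - a) * K1 * K2)^-1 = (2 * (b - a))^-1 / (K1 * K2).
  by rewrite -mulrA invfM.
rewrite -mulrA ler_wpM2l ?invr_ge0 ?(ltW ba)//.
rewrite (le_trans (ler_normD _ _))//.
rewrite (le_trans (lerD (ler_normD _ _) (lexx _)))//.
rewrite (le_trans (lerD (lerD left_le mid_le) right_le))//.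
by rewrite sumE.
Qed.
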